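(* Let $\chi$ be a rainbow feasible coloring of the planar integer lattice $\mathbb{Z}^2$. There is an integer $A$ independent of the coloring and a point $z\in\mathbb{Z}^2$ such that there is either a monochromatic parallelogram of area $A$ or a rainbow trapezoid of area $A$, with $z$ one of its vertices.
   Context: A $3$-coloring of the integer lattice $\mathbb{Z}^2$ (a coloring of its points with three colors) is called rainbow feasible if there is an integer $N$ such that in every interval of length $N$ in every horizontal line each color appears at least $(N+4)/6$ times; here an interval of length $N$ in a horizontal line is a set of $N$ consecutive lattice points on that line. Only vertex colors are considered: a monochromatic parallelogram is a set of four points of the lattice which are the vertices of a parallelogram and are assigned the same color, and likewise a trapezoid is considered through the set of its four vertices in the lattice. For a coloring $\chi$ of a set $X$, a subset $Y\subset X$ is rainbow under $\chi$ if $|\chi(Y)|=\min\{|\chi(X)|,|Y|\}$, that is, either no two elements of $Y$ have the same color, or all colors in $\chi(X)$ are present in $Y$. A trapezoid is rainbow if its set of vertices is rainbow. *)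

(* Defs.v *)
From HB Require Import structures.
From mathcomp Require Import all_boot all_order all_algebra.
From mathcomp Require Import finmap.
From mathcomp Require Import boolp classical_sets functions cardinality.

Set Implicit Arguments.
Unset Strict Implicit.
Unset Printing Implicit Defensive.

Import Order.TTheory GRing.Theory Num.Theory.
Local Open Scope ring_scope.

Notation Z2 := (int * int)%type.

Section Colorings.
Variables (X : choiceType) (C : finType) (chi : X -> C).

Definition monochromatic (Y : {fset X}) : Prop :=
  exists c : C, forall y : X, y \in Y -> chi y = c.

(* The range of chi is finite since C is, so fset_set is faithful on it. *)
Definition rainbow (Y : {fset X}) : Prop :=
  #|` [fset chi y | y in Y]%fset | =
  minn #|` fset_set (range chi) | #|` Y |.

End Colorings.

(* The interval of length N starting at (x, y) is (x, y), ..., (x + N - 1, y).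
   No interval of length 0 contains at least (0 + 4) / 6 points of a color, so
   N is automatically positive. *)
Definition rainbow_feasible (chi : Z2 -> 'I_3) : Prop :=
  exists N : nat, forall (x y : int) (c : 'I_3),
    (N%:R + 4) / 6 <= #|[set k : 'I_N | chi (x + k%:Z, y) == c]|%:R :> rat.

Definition cross (u v : Z2) : int := u.1 * v.2 - u.2 * v.1.

Definition parallel (u v : Z2) : bool := cross u v == 0.

(* Vertices in cyclic order: the closed path p q r s turns strictly to the same
   side at each vertex. Four turns of angle less than pi add up to 2 pi, so the
   path is the boundary of a nondegenerate convex quadrilateral. *)
Definition convex_quad (p q r s : Z2) : bool :=
  let t := [:: cross (q - p) (r - q); cross (r - q) (s - r);
               cross (s - r) (p - s); cross (p - s) (q - p)] in
  all (fun x => 0 < x) t || all (fun x => x < 0) t.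

Definition parallelogram (p q r s : Z2) : bool :=
  [&& convex_quad p q r s, parallel (q - p) (s - r) & parallel (r - q) (p - s)].

(* Exactly one pair of parallel sides. A simple quadrilateral with two parallel
   sides is convex, so requiring convexity excludes only crossed paths and
   degenerate quadrilaterals. *)
Definition trapezoid (p q r s : Z2) : bool :=
  convex_quad p q r s &&
  (parallel (q - p) (s - r) (+) parallel (r - q) (p - s)).

(* Shoelace formula. *)
Definition area (p q r s : Z2) : rat :=
  `|cross p q + cross q r + cross r s + cross s p|%:~R / 2.

Definition vertices (p q r s : Z2) : {fset Z2} := [fset p; q; r; s]%fset.

(* Main.v *)
Require Import Defs.
From mathcomp Require Import all_boot all_order all_algebra.
From mathcomp Require Import finmap.
From mathcomp Require Import classical_sets cardinality.
From mathcomp Require Import zify ring.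
Import Order.TTheory GRing.Theory Num.Theory.
Local Open Scope ring_scope.

(** The area of a quadrilateral with two horizontal sides depends only on the
    lengths of these sides and on the distance between their lines, not on how
    far one side is shifted against the other. So the two sides can be chosen
    independently: with sides of lengths 1 and 3 on consecutive lines the area
    is always 2, and the two remaining sides are never parallel.

    Feasibility puts every color on every horizontal line. Hence some line
    contains two neighbors of different colors
    ([rainbow_feasible_bichromatic]), and the next line contains a point of the
    third color. A trapezoid with these neighbors as its short side and that
    point as an end of its long side carries all three colors, whatever the
    color of its last vertex. As the shift between the two sides is free, the
    third color may first occur arbitrarily far away, so that A = 2 works for
    every interval length N. *)

(** As [(N + 4) / 6] is positive, the interval of length [N] that starts at
    [(x, y)] already contains the color. *)
Lemma rainbow_feasible_color (chi : Z2 -> 'I_3) (x y : int) (c : 'I_3) :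
  rainbow_feasible chi -> exists k : nat, chi (x + k%:Z, y) = c.
Proof.
move=> [N /(_ x y c) countP].
have bound_gt0 : (0 : rat) < (N%:R + 4) / 6.
  by rewrite divr_gt0 ?ltr_wpDl ?ler0n.
have := lt_le_trans bound_gt0 countP; rewrite ltr0n.
by case/card_gt0P => k; rewrite inE => /eqP; exists k.
Qed.

Lemma neq_succ_of_neq (T : eqType) (f : nat -> T) (n : nat) :
  f n != f 0%N -> exists k, f k.+1 != f k.
Proof.
elim: n => [|n IHn]; first by rewrite eqxx.
by have [-> /IHn|? _] := eqVneq (f n.+1) (f n); last by exists n.
Qed.

Lemma rainbow_feasible_bichromatic (chi : Z2 -> 'I_3) (y : int) :
  rainbow_feasible chi -> exists x : int, chi (x + 1, y) != chi (x, y).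
Proof.
move=> feas.
have [c c_neq] : exists c, c != chi (0, y).
  by case: (chi (0, y)) => -[|m] lt_m; [exists (inord 1) | exists ord0];
    rewrite -val_eqE //= inordK.
have [n chi_n] := @rainbow_feasible_color chi 0 y c feas.
have [|k chi_k] := @neq_succ_of_neq _ (fun k : nat => chi (k%:Z, y)) n.
  by rewrite -[n%:Z]add0r chi_n.
by exists k%:Z; rewrite -PoszD addn1.
Qed.

(** The image of [Y] is then the whole range, and it has at most as many
    elements as [Y], so the minimum in the definition is attained by the
    range. *)
Lemma rainbow_surj (X : choiceType) (C : finType) (chi : X -> C)
    (Y : {fset X}) :
  (forall c, exists2 y, y \in Y & chi y = c) -> rainbow chi Y.
Proof.
move=> Ysurj; rewrite /rainbow.
have -> : fset_set (range chi) = [fset chi y | y in Y]%fset.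
  apply/fsetP => c; have [y Yy <-] := Ysurj c.
  rewrite in_fset_set; last exact: finite_finset.
  by rewrite in_imfset //= mem_set //; exists y.
by apply/esym/minn_idPl/leq_imfset_card.
Qed.

Lemma ord3_cover (a b : 'I_3) :
  b != a -> exists d : 'I_3, forall e, [|| e == a, e == b | e == d].
Proof.
move=> b_neq_a.
(* The colors 0, 1, 2 add up to 3, so the third one is 3 minus the others. *)
exists (inord (3 - a - b)) => e.
rewrite -val_eqE /= in b_neq_a.
have lt_a := ltn_ord a; have lt_b := ltn_ord b; have lt_e := ltn_ord e.
rewrite -!val_eqE /= inordK; lia.
Qed.

Section Strip.
Variables x x' y : int.

Let p : Z2 := (x, y).
Let q : Z2 := (x + 1, y).
Let r : Z2 := (x' + 3, y + 1).
Let s : Z2 := (x', y + 1).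

(** Each of the four turns is the height 1 times the length 1 or 3 of a
    horizontal side, so the path is convex for all [x] and [x']; the slanted
    sides would be parallel only if the two lengths agreed. *)
Lemma trapezoid_strip : trapezoid p q r s.
Proof.
rewrite /trapezoid /convex_quad /parallel /cross /=.
by apply/andP; split; lia.
Qed.

Lemma area_strip : area p q r s = 2.
Proof.
rewrite /area /cross /=.
have -> : x * y - y * (x + 1) + ((x + 1) * (y + 1) - y * (x' + 3)) +
  ((x' + 3) * (y + 1) - (y + 1) * x') + (x' * y - (y + 1) * x) = 4 by ring.
by [].
Qed.

End Strip.

Theorem theorem3 :
  exists A : int,
  forall chi : Z2 -> 'I_3, rainbow_feasible chi ->
  exists z : Z2,
    (exists p q r s : Z2,
       [/\ parallelogram p q r s, area p q r s = A%:~R,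
           monochromatic chi (vertices p q r s) & z \in vertices p q r s]) \/
    (exists p q r s : Z2,
       [/\ trapezoid p q r s, area p q r s = A%:~R,
           rainbow chi (vertices p q r s) & z \in vertices p q r s]).
Proof.
exists 2 => chi feas.
have [x chi_x] := @rainbow_feasible_bichromatic chi 0 feas.
have [d dP] := @ord3_cover _ _ chi_x.
have [k chi_k] := @rainbow_feasible_color chi 0 (0 + 1) d feas.
set x' := 0 + k%:Z in chi_k.
exists (x, 0); right; exists (x, 0), (x + 1, 0), (x' + 3, 0 + 1), (x', 0 + 1).
split; [exact: trapezoid_strip | exact: area_strip | |].
  apply: rainbow_surj => c; case/or3P: (dP c) => /eqP->.
  - by exists (x, 0) => //; rewrite !inE eqxx.
  - by exists (x + 1, 0) => //; rewrite !inE eqxx !orbT.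
  - by exists (x', 0 + 1) => //; rewrite !inE eqxx !orbT.
by rewrite !inE eqxx.
Qed.
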